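(* In the following let $R$ be the circumradius of a cyclic $n$-gon. (i) A triangle with sides $a,b,c$ and circumradius $R$ satisfies $$abc\le R^2(a+b+c).$$ Equality holds if and only if the triangle is equilateral. (ii) The sides $a,b,c,d$ and diagonals $e,f$ of a cyclic quadrangle with circumradius $R$ satisfy $$abcdef\le R^3(abe+bcf+cde+adf).$$ Equality holds if and only if the quadrangle is equilateral. (iii) The vertices $z_j$, $j=1,\ldots,n$, of a cyclic $n$-gon ($n\ge3$) with circumradius $R$ satisfy $$\prod_{1\le j<i\le n}|z_i-z_j|\le R^{\frac{(n+1)(n-2)}{2}}\,(n-2)!\sum_{1\le j<i\le n}|z_i-z_j|.$$ (iv) Let $z_1,\ldots,z_n\in\mathbb{C}$ be the vertices of a cyclic $n$-gon ($n\ge 3$) and let $y$ be the center of its circumcircle. Then equality holds in the simplex inequality $$d_V(z_1,\ldots,z_n)\le\sum_{i=1}^n d_V(z_1,\ldots,z_{i-1},y,z_{i+1},\ldots,z_n)$$ if and only if the $n$-gon is equilateral.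
   Context: $d_V(z_1,\ldots,z_n)=\prod_{1\le j<i\le n}|z_i-z_j|$ for $z_1,\ldots,z_n\in\mathbb{C}$ (the Vandermonde $n$-metric). A cyclic $n$-gon is an $n$-gon in the plane $\mathbb{C}$ whose $n$ vertices are pairwise distinct points on a circle (the circumcircle), whose radius $R>0$ is the circumradius; its sides join vertices which are consecutive in the order around the circle. It is equilateral if all its sides have equal length. The letters $a,b,c,\dots$ denote lengths. In (ii) the sides $a,b,c,d$ are named consecutively around the quadrangle, the diagonal $e$ forms a triangle with the sides $a,b$ (and with $c,d$), and the diagonal $f$ forms a triangle with the sides $b,c$ (and with $a,d$). *)

(* Defs.v *)
From mathcomp Require Export all_boot all_order all_algebra.
From mathcomp Require Export complex.
From mathcomp Require Export reals trigo.

Set Implicit Arguments.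
Unset Strict Implicit.
Unset Printing Implicit Defensive.

Import Order.TTheory GRing.Theory Num.Theory.
Local Open Scope ring_scope.
Local Open Scope complex_scope.

(* [normc] is the R-valued modulus; the generic norm on R[i] takes its values
   in R[i]. *)
Definition dist (R : realType) (z w : R[i]) : R :=
  ComplexField.Normc.normc (z - w).

Definition dV (R : realType) (n : nat) (z : 'I_n -> R[i]) : R :=
  \prod_(i < n) \prod_(j < n | (j < i)%N) dist (z i) (z j).

(* The vertices may be labelled in any order: labels need not follow the order
   around the circle. The circumcircle has centre y and radius r. *)
Definition cyclic_ngon (R : realType) (n : nat) (z : 'I_n -> R[i])
    (y : R[i]) (r : R) : Prop :=
  [/\ 0 < r, injective z & forall i, dist (z i) y = r].

Definition circle_point (R : realType) (y : R[i]) (r t : R) : R[i] :=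
  y + (r * cos t +i* (r * sin t)).

(* z j is the vertex that follows z i counterclockwise: the open arc from z i
   to z j contains no vertex. *)
Definition next_vertex (R : realType) (n : nat) (z : 'I_n -> R[i])
    (y : R[i]) (r : R) (i j : 'I_n) : Prop :=
  exists s t : R,
    [/\ s < t < s + pi *+ 2,
        z i = circle_point y r s,
        z j = circle_point y r t
      & forall (k : 'I_n) (u : R), s < u < t -> z k <> circle_point y r u].

Definition is_side (R : realType) (n : nat) (z : 'I_n -> R[i])
    (y : R[i]) (r : R) (i j : 'I_n) : Prop :=
  next_vertex z y r i j \/ next_vertex z y r j i.

Definition equilateral (R : realType) (n : nat) (z : 'I_n -> R[i])
    (y : R[i]) (r : R) : Prop :=
  forall i j k l : 'I_n, is_side z y r i j -> is_side z y r k l ->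
    dist (z i) (z j) = dist (z k) (z l).

(* Main.v *)
(** Put u_i = z_i - y. Evaluating at 0 the Lagrange interpolation of the constant 1
    at the nodes u_i gives sum_i w_i = 1, where
    w_i = prod_(k <> i) u_k / (u_k - u_i), and replacing z_i by y multiplies d_V
    by |w_i|. This yields the simplex inequality, with equality iff all w_i are
    nonnegative reals. As conj u = r^2 / u on the circle, w_i is real
    iff (-u_i)^(n-1) = prod_(k <> i) u_k, so equality forces all the powers u_i^n
    to coincide; conversely the nodes are then the roots of X^n - c and every w_i
    is 1/n. Having equal n-th powers means that the polygon is regular: the chords
    determine the arcs between neighbours up to g <-> 2 pi - g, and for n >= 3 two
    arcs cannot add up to 2 pi. Iterating the simplex inequality down to two
    points gives (iii). *)

Require Import Defs.
From mathcomp Require Import ring lra zify.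

Set Implicit Arguments.
Unset Strict Implicit.
Unset Printing Implicit Defensive.

Import Order.TTheory GRing.Theory Num.Theory.
Local Open Scope ring_scope.

(** * Lagrange interpolation of the constant 1 *)

(** The sum minus 1 is a polynomial in [y] of size at most [n.+1] vanishing at the [n.+1] distinct
    nodes: at [u j] the basis polynomial [L j] is 1 and the others are 0. *)
Lemma lagrange_sum1 (F : fieldType) (n : nat) (u : 'I_n.+1 -> F) (y : F) :
  injective u ->
  \sum_i \prod_k ((y - u (lift i k)) / (u i - u (lift i k))) = 1.
Proof.
move=> u_inj.
pose L (i : 'I_n.+1) : {poly F} :=
  \prod_k ((u i - u (lift i k))^-1 *: ('X - (u (lift i k))%:P)).
have LE i x : (L i).[x] = \prod_k ((x - u (lift i k)) / (u i - u (lift i k))).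
  rewrite horner_prod; apply: eq_bigr => k _.
  by rewrite hornerZ hornerXsubC mulrC.
pose p := \sum_i L i - 1.
have u_neq i k : u i - u (lift i k) != 0.
  by rewrite subr_eq0; apply/eqP => /u_inj /eqP; rewrite (negPf (neq_lift i k)).
have szL i : (size (L i) <= n.+1)%N.
  apply: leq_trans (size_poly_prod_leq _ _) _; rewrite leq_subLR card_ord.
  have -> : (n + n.+1 = (\sum_(k < n) 2).+1)%N.
    by rewrite sum_nat_const card_ord muln2 -addnn addnS.
  rewrite ltnS; apply: leq_sum => k _.
  by apply: leq_trans (size_scale_leq _ _) _; rewrite size_XsubC.
suff /eqP : p = 0.
  rewrite subr_eq0 => /eqP/(congr1 (horner^~ y)).
  rewrite horner_sum hornerC => sL; rewrite -[RHS]sL.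
  by apply: eq_bigr => i _; rewrite LE.
apply: (@roots_geq_poly_eq0 _ _ (codom u)).
- apply/allP => _ /codomP[j ->]; rewrite rootE hornerD hornerN hornerC.
  rewrite horner_sum (bigD1 j)//= [X in _ + X - 1]big1 => [|i].
    by rewrite LE big1 ?addr0 ?subrr// => k _; rewrite divff.
  case: (unliftP i j) => [k -> _|->]; last by rewrite eqxx.
  by rewrite LE (bigD1 k)//= subrr !mul0r.
- by rewrite map_inj_uniq// enum_uniq.
- rewrite size_codom card_ord (leq_trans (size_polyD _ _))// geq_max.
  rewrite size_polyN size_poly1 andbT.
  by apply: (leq_trans (size_sum _ _ _)); apply/bigmax_leqP.
Qed.

(** * Weights of nodes on a circle about the origin *)

Section Circle.
Variables (C : numClosedFieldType) (n : nat) (u : 'I_n.+1 -> C) (rho : C).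
Hypotheses (rho_gt0 : 0 < rho) (u_inj : injective u).
Hypothesis norm_u : forall i, `|u i| = rho.

Let w i := \prod_k ((0 - u (lift i k)) / (u i - u (lift i k))).

Let u_neq0 i : u i != 0. Proof. by rewrite -normr_gt0 norm_u. Qed.

Let u_sub_neq0 i k : u i - u (lift i k) != 0.
Proof.
by rewrite subr_eq0; apply/eqP => /u_inj /eqP; rewrite (negPf (neq_lift i k)).
Qed.

Let conj_u i : (u i)^* = rho ^+ 2 / u i.
Proof.
by apply: (mulfI (u_neq0 i)); rewrite -normCK norm_u mulrCA divff ?mulr1.
Qed.

(** Conjugation sends [u k] to [rho ^+ 2 / u k], which multiplies the factor of [w i] at a node [v]
    by [- u i / v]. As [w i] is nonzero, its being real forces the product of these ratios to be
    1. *)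
Lemma real_weight_expn i :
  w i \is Num.real -> u i ^+ n.+1 = (-1) ^+ n * \prod_j u j.
Proof.
rewrite CrealE => /eqP w_real.
have w_neq0 : w i != 0.
  by apply/prodf_neq0 => k _; rewrite mulf_neq0 ?invr_eq0 ?sub0r ?oppr_eq0.
have : w i = (\prod_(k < n) (- u i / u (lift i k))) * w i.
  rewrite -[LHS]w_real /w rmorph_prod -big_split; apply: eq_bigr => k _ /=.
  have := u_neq0 i; have := u_neq0 (lift i k); have := u_sub_neq0 i k.
  rewrite rmorphM/= fmorphV !rmorphB/= !conj_u rmorph0.
  have rho_neq0 : rho != 0 by rewrite gt_eqF.
  move=> h1 h2 h3.
  have -> : rho ^+ 2 / u i - rho ^+ 2 / u (lift i k) =
     - (rho ^+ 2 / (u i * u (lift i k))) * (u i - u (lift i k)).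
    by field; rewrite h2 h3.
  by field; rewrite ?h1 ?h2 ?h3 ?rho_neq0.
rewrite -[X in X = _]mul1r => /(mulIf w_neq0)/esym.
rewrite big_split/= prodr_const card_ord prodfV => /divr1_eq pE.
by rewrite (bigD1_ord i)//= -pE (exprNn (u i)) exprS [RHS]mulrCA signrMK.
Qed.

(** The nodes are all the roots of ['X^(n.+1) - c]. Its value at 0 gives the numerator of [w i], its
    derivative at [u i] the denominator. *)
Lemma weight_expn_const c i : (forall j, u j ^+ n.+1 = c) -> w i = n.+1%:R^-1.
Proof.
move=> u_expn.
have PE : 'X^(n.+1) - c%:P = \prod_j ('X - (u j)%:P).
  have sz : size ('X^(n.+1) - c%:P) = n.+2 by rewrite size_XnsubC.
  have /all_roots_prod_XsubC -> : size ('X^(n.+1) - c%:P) = (size (codom u)).+1.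
  - by rewrite sz size_codom card_ord.
  - by rewrite lead_coefXnsubC// scale1r big_map big_enum.
  - apply/allP => _ /codomP[j ->].
    by rewrite rootE !hornerE u_expn subrr.
  - by rewrite uniq_rootsE map_inj_uniq// enum_uniq.
have P0 : - c = \prod_j (0 - u j).
  have := congr1 (horner^~ 0) PE; rewrite !hornerE expr0n sub0r => ->.
  by rewrite horner_prod; apply: eq_bigr => j _; rewrite hornerXsubC.
have P' : u i ^+ n *+ n.+1 = \prod_k (u i - u (lift i k)).
  have := congr1 (fun p => p^`().[u i]) PE.
  rewrite derivB derivXn derivC subr0 hornerMn hornerXn => ->.
  rewrite (bigD1_ord i)//= derivM derivXsubC !hornerE subrr mul0r addr0.
  by rewrite horner_prod; apply: eq_bigr => j _; rewrite hornerXsubC.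
rewrite /w big_split/= prodfV -P' -mulr_natr invfM.
have -> : \prod_k (0 - u (lift i k)) = u i ^+ n.
  have ui : 0 - u i != 0 by rewrite sub0r oppr_eq0.
  apply: (mulfI ui); move: P0; rewrite (bigD1_ord i)//= => <-.
  by rewrite sub0r mulNr -exprS u_expn.
by rewrite mulrA divff ?mul1r// expf_neq0.
Qed.

Lemma sum_norm_weight_eq1 :
  \sum_i `|w i| = 1 <-> exists c, forall i, u i ^+ n.+1 = c.
Proof.
split=> [sw|[c uc]]; last first.
  rewrite (eq_bigr (fun=> n.+1%:R^-1)) => [|i _].
    by rewrite sumr_const card_ord -[LHS]mulr_natr mulVf// pnatr_eq0.
  by rewrite (weight_expn_const i uc) ger0_norm// invr_ge0.
have sw1 : \sum_i w i = 1 by apply: lagrange_sum1.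
(* As the weights sum to 1, [sw] is the equality case of the triangle inequality: all weights share
   one phase [t], and summing shows [t = 1]. *)
have [t t1 wt] : {t : C | `|t| == 1 & forall i, true -> w i = `|w i| * t}.
  by apply: (@normC_sum_eq _ _ xpredT w); rewrite sw1 sw normr1.
have tE : t = 1.
  rewrite -[LHS]mul1r -[X in X * t]sw mulr_suml -[RHS]sw1.
  by apply: eq_bigr => i _; rewrite -wt.
exists ((-1) ^+ n * \prod_j u j) => i; apply: real_weight_expn.
by rewrite (wt i)// tE mulr1 normr_real.
Qed.

End Circle.

Local Open Scope complex_scope.

(** * Angles and points on a circle *)

Section Angles.
Variable R : realType.
Implicit Types (t g h r : R) (y : R[i]).

Lemma cos_lt1 t : 0 < t < pi *+ 2 -> cos t < 1.
Proof.
move=> t_bd; have : 0 < sin (t / 2) by apply: sin_gt0_pi; lra.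
have -> : cos t = cos (t / 2) ^+ 2 *+ 2 - 1.
  by rewrite -cos_mulr2n; congr cos; field.
by rewrite cos2sin2 => /(exprn_gt0 2); lra.
Qed.

(** Used to recover an arc from its chord, up to the complementary arc. Angles beyond [pi] are
    reflected to [pi *+ 2 - x], since cosine is injective on [[0, pi]]. *)
Lemma cos_eq_arc g h : 0 < g < pi *+ 2 -> 0 < h < pi *+ 2 ->
  cos g = cos h -> g = h \/ g + h = pi *+ 2.
Proof.
have fold_cos x : cos (pi *+ 2 - x) = cos x :> R.
  by rewrite addrC cosD2pi cosN.
move=> g_bd h_bd gh.
case: (leP g pi) => gpi; case: (leP h pi) => hpi.
- left; apply: cos_inj => //; rewrite in_itv/=; lra.
- right; suff -> : g = pi *+ 2 - h by ring.
  by apply: cos_inj; rewrite ?in_itv/= ?fold_cos//; lra.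
- right; suff -> : h = pi *+ 2 - g by ring.
  by apply: cos_inj; rewrite ?in_itv/= ?fold_cos//; lra.
- left; suff : pi *+ 2 - g = pi *+ 2 - h by lra.
  by apply: cos_inj; rewrite ?in_itv/= ?fold_cos//; lra.
Qed.

Definition expi t : R[i] := cos t +i* sin t.

Lemma expiD s t : expi (s + t) = expi s * expi t.
Proof.
by apply/eqP; rewrite eq_complex /= cosD sinD eqxx/= addrC eqxx.
Qed.

Lemma expiX t n : expi t ^+ n = expi (t *+ n).
Proof.
elim: n => [|n IH]; first by rewrite expr0 mulr0n /expi cos0 sin0.
by rewrite exprS IH mulrS expiD.
Qed.

Lemma expi2pi : expi (pi *+ 2) = 1.
Proof. by rewrite /expi cos2pi sin2pi. Qed.

Lemma expi_neq1 t : 0 < t < pi *+ 2 -> expi t != 1.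
Proof.
by move=> /cos_lt1 ct; apply/eqP => -[c1 _]; move: ct; rewrite c1 ltxx.
Qed.

Lemma expi_neq0 t : expi t != 0.
Proof.
apply/eqP => -[c0 s0]; have /eqP := cos2Dsin2 t.
by rewrite c0 s0 expr0n addr0 eq_sym oner_eq0.
Qed.

Lemma circle_pointE y r t : circle_point y r t = y + r%:C * expi t.
Proof.
by rewrite /circle_point /expi; congr (_ + _); apply/eqP;
  rewrite eq_complex /= !mul0r subr0 addr0 !eqxx.
Qed.

Lemma circle_point_sub y r t : circle_point y r t - y = r%:C * expi t.
Proof. by rewrite circle_pointE addrAC subrr add0r. Qed.

Lemma circle_point_neq y r s t : 0 < r -> 0 < t - s < pi *+ 2 ->
  circle_point y r s <> circle_point y r t.
Proof.
move=> r0 /expi_neq1 /eqP; rewrite !circle_pointE => st /addrI.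
have rC : r%:C != 0 by apply/eqP => -[re]; rewrite re ltxx in r0.
move=> /(mulfI rC); have -> : t = s + (t - s) by ring.
rewrite expiD -[X in X = _]mulr1 => /(mulfI (expi_neq0 s)) e; apply: st.
by rewrite -e.
Qed.

Lemma dist_sqr (z w : R[i]) : dist z w ^+ 2 =
  (complex.Re z - complex.Re w) ^+ 2 + (complex.Im z - complex.Im w) ^+ 2.
Proof.
by case: z w => [a b] [c d]; rewrite /dist /= sqr_sqrtr// addr_ge0// sqr_ge0.
Qed.

Lemma dist_ge0 (z w : R[i]) : 0 <= dist z w.
Proof. by case: z w => [a b] [c d]; rewrite /dist /= sqrtr_ge0. Qed.

Lemma dist_circle_point y r s t :
  dist (circle_point y r s) (circle_point y r t) ^+ 2 =
  r ^+ 2 * (2 * (1 - cos (t - s))).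
Proof.
rewrite dist_sqr /circle_point /= cosB.
have := cos2Dsin2 s; have := cos2Dsin2 t; case: y => [a b] /= ht hs.
(* Arranged so that [cos ^+ 2 + sin ^+ 2] appears for [t] and for [s] and can be replaced by 1,
   leaving half the squared unit chord. *)
have -> : 1 - (cos t * cos s + sin t * sin s) =
  (1 - (cos t ^+ 2 + sin t ^+ 2)) / 2 + (1 - (cos s ^+ 2 + sin s ^+ 2)) / 2
  + ((cos t - cos s) ^+ 2 + (sin t - sin s) ^+ 2) / 2 by field.
by rewrite ht hs; field.
Qed.

Lemma circle_point_polar (z : R[i]) y r : 0 < r -> dist z y = r ->
  exists t, 0 <= t < pi *+ 2 /\ z = circle_point y r t.
Proof.
move=> r0 /(congr1 (fun x => x ^+ 2)); rewrite dist_sqr.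
case: z y => [a b] [c d] /= pq; set p := (a - c) / r; set q := (b - d) / r.
have rn0 : r != 0 by rewrite gt_eqF.
have pq1 : p ^+ 2 + q ^+ 2 = 1.
  by rewrite !exprMn !exprVn -mulrDl pq divff// expf_neq0.
have p_bd : -1 <= p <= 1 by have := sqr_ge0 q; nra.
have sin_acosp : sin (acos p) = `|q|.
  by rewrite sin_acos// -[1]pq1 addrAC subrr add0r sqrtr_sqr.
suff [t [t_bd ct st]] : exists t, [/\ 0 <= t < pi *+ 2, cos t = p & sin t = q].
  exists t; split=> //; rewrite /circle_point ct st; apply/eqP.
  by rewrite eq_complex /= ![r * _]mulrC !divfK// ![_ + (_ - _)]addrC !subrK !eqxx.
have pi0 := pi_gt0 R; have acos0 := acos_ge0 p_bd; have acospi := acos_lepi p_bd.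
case: (leP 0 q) => q0.
  exists (acos p); split; first lra.
    by rewrite acosK// in_itv.
  by rewrite sin_acosp ger0_norm.
(* For negative [q] the angle [acos p] has the wrong sign of sine and is reflected. Here [p = 1] is
   excluded, so the reflected angle stays below [pi *+ 2]. *)
have p1 : -1 <= p < 1 by nra.
have acosp_gt0 := acos_gt0 p1.
exists (pi *+ 2 - acos p); split; first lra.
  by rewrite addrC cosD2pi cosN acosK// in_itv.
by rewrite addrC sinD2pi sinN sin_acosp ltr0_norm// opprK.
Qed.

End Angles.

(** * Equilateral polygons and equal powers *)

Section Polygon.
Variables (R : realType) (n : nat) (z : 'I_n.+1 -> R[i]) (y : R[i]) (r : R).
Hypothesis zyr : cyclic_ngon z y r.

Let r_gt0 : 0 < r. Proof. by case: zyr. Qed.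
Let rC_neq0 : r%:C != 0.
Proof. by apply/eqP => -[re]; move: r_gt0; rewrite re ltxx. Qed.

(** The angles are sorted in [[0, 2 pi)] and the list is closed by the first angle plus a full turn,
    so that the last gap is treated like the others. *)
Lemma angular_order : exists b : nat -> R,
  [/\ forall k l, (k < l <= n.+1)%N -> b k < b l,
      b n.+1 = b 0%N + pi *+ 2,
      forall k, (k <= n.+1)%N -> exists i, z i = circle_point y r (b k)
    & forall i, exists2 k, (k <= n)%N & z i = circle_point y r (b k)].
Proof.
case: zyr => _ z_inj z_circle.
have [th th_z] := fin_all_exists (fun i => circle_point_polar r_gt0 (z_circle i)).
pose s := sort <=%R (codom th).
have size_s : size s = n.+1 by rewrite size_sort size_codom card_ord.
have mem_s t : (t \in s) = (t \in codom th) by rewrite mem_sort.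
have lt_s : sorted <%R s.
  rewrite lt_sorted_uniq_le sort_uniq sort_sorted ?andbT; last exact: le_total.
  rewrite map_inj_uniq ?enum_uniq// => i j th_ij; apply: z_inj.
  by rewrite (th_z i).2 (th_z j).2 th_ij.
have s_bd k : (k <= n)%N -> 0 <= s`_k < pi *+ 2.
  move=> kn; have : s`_k \in s by rewrite mem_nth// size_s.
  by rewrite mem_s => /codomP[i ->]; case: (th_z i).
have s_vertex k : (k <= n)%N -> exists i, z i = circle_point y r s`_k.
  move=> kn; have : s`_k \in s by rewrite mem_nth// size_s.
  by rewrite mem_s => /codomP[i ->]; exists i; case: (th_z i).
pose b k := if (k <= n)%N then s`_k else s`_0 + pi *+ 2.
exists b; rewrite /b; split.
- move=> k l /andP[kl ln].
  have kn : (k <= n)%N by lia.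
  rewrite kn; case: ifP => [ln'|_].
    by apply: (sorted_ltn_nth lt_trans); rewrite ?inE ?size_s.
  by have := s_bd k kn; have := s_bd 0%N isT; lra.
- by rewrite ltnn.
- move=> k kn; case: ifP => [|_]; first exact: s_vertex.
  have [i zi] := s_vertex 0%N isT; exists i.
  by rewrite zi /circle_point cosD2pi sinD2pi.
- move=> i; have : th i \in s by rewrite mem_s codom_f.
  move=> /(nthP 0)[k]; rewrite size_s => kn skE; exists k => //.
  by rewrite -ltnS kn skE; case: (th_z i).
Qed.

(** Equal sides make all gaps equal to some [g] with [g *+ n.+1 = pi *+ 2]; raising to the power
    [n.+1] then erases the index of the vertex. *)
Lemma equilateral_expn : (2 <= n)%N -> equilateral z y r ->
  exists c, forall i, (z i - y) ^+ n.+1 = c.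
Proof.
move=> n2 eq_sides; have [b [b_lt bn b_z z_b]] := angular_order.
have b_le k l : (k <= l <= n.+1)%N -> b k <= b l.
  move=> /andP[]; rewrite leq_eqVlt => /predU1P[->//|kl] ln.
  by rewrite ltW// b_lt// kl.
have gap_bd k : (k <= n)%N -> 0 < b k.+1 - b k < pi *+ 2.
  move=> kn; have ltk : b k < b k.+1 by apply: b_lt; lia.
  have [k0|k0] := posnP k.
    by have : b k.+1 < b n.+1 by [apply: b_lt; lia]; rewrite k0 in ltk *; lra.
  by have : b 0%N < b k by [apply: b_lt; lia]; have : b k.+1 <= b n.+1
    by [apply: b_le; lia]; lra.
(* Consecutive angles bound an empty arc: an angle strictly between them differs from every [b l] by
   a nonzero amount smaller than a full turn. *)
have next_b k i j : (k <= n)%N -> z i = circle_point y r (b k) ->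
    z j = circle_point y r (b k.+1) -> next_vertex z y r i j.
  move=> kn zi zj; exists (b k), (b k.+1); split=> //.
    by have := gap_bd k kn; lra.
  move=> m u ku; have [l ln ->] := z_b m.
  have [lk|kl] := leqP l k.
    apply: circle_point_neq => //; have : b l <= b k by apply: b_le; lia.
    have : b k.+1 <= b n.+1 by apply: b_le; lia.
    by have : b 0%N <= b l by [apply: b_le; lia]; lra.
  apply: nesym; apply: circle_point_neq => //.
  have : b k.+1 <= b l by apply: b_le; lia.
  have : b l < b n.+1 by apply: b_lt; lia.
  by have : b 0%N <= b k by [apply: b_le; lia]; lra.
have gap_eq k : (k < n)%N -> b k.+2 - b k.+1 = b k.+1 - b k.
  move=> kn; have [i zi] := b_z k ltac:(lia).
  have [j zj] := b_z k.+1 ltac:(lia); have [l zl] := b_z k.+2 ltac:(lia).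
  have ij := next_b k _ _ ltac:(lia) zi zj.
  have jl := next_b k.+1 _ _ ltac:(lia) zj zl.
  have := eq_sides _ _ _ _ (or_introl ij) (or_introl jl).
  move/(congr1 (fun x => x ^+ 2)); rewrite zi zj zl !dist_circle_point.
  have r2 : r ^+ 2 != 0 by rewrite expf_neq0// gt_eqF.
  move=> /(mulfI r2) cos_eq.
  have [|||//|sum_gap] := @cos_eq_arc _ (b k.+2 - b k.+1) (b k.+1 - b k).
  - by apply: gap_bd; lia.
  - by apply: gap_bd; lia.
  - by move: cos_eq; lra.
  (* In the other case two adjacent gaps would fill the whole turn, but with at least three vertices
     a further gap remains. *)
  have : b k.+2 <= b n.+1 by apply: b_le; lia.
  have : b 0%N <= b k by apply: b_le; lia.
  have [k0|k0] := posnP k.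
    by have : b k.+2 < b n.+1 by [apply: b_lt; lia]; lra.
  by have : b 0%N < b k by [apply: b_lt; lia]; lra.
pose g := b 1%N - b 0%N.
have gapE k : (k <= n)%N -> b k.+1 - b k = g.
  by elim: k => // k IH kn; rewrite gap_eq// IH// ltnW.
have bE k : (k <= n.+1)%N -> b k = b 0%N + g *+ k.
  elim: k => [|k IH] kn; first by rewrite addr0.
  by rewrite mulrSr addrA -IH ?(ltnW kn)// -(gapE k)// addrC subrK.
have gn : g *+ n.+1 = pi *+ 2 by apply: (addrI (b 0%N)); rewrite -bE// bn.
exists ((r%:C * expi (b 0%N)) ^+ n.+1) => i.
have [k kn ->] := z_b i; rewrite circle_point_sub.
rewrite bE; last lia.
rewrite expiD -(expiX g) mulrA exprMn -exprM mulnC exprM expiX gn expi2pi.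
by rewrite expr1n mulr1.
Qed.

(** The vertices are all the solutions of [(x - y) ^+ n.+1 = c], a set invariant under rotation by
    [d] about [y]; so every gap is exactly [d]. *)
Lemma expn_equilateral c :
  (forall i, (z i - y) ^+ n.+1 = c) -> equilateral z y r.
Proof.
move=> zc; have z_inj : injective z by case: zyr.
pose d : R := pi *+ 2 / n.+1%:R.
have n0 : n.+1%:R != 0 :> R by rewrite pnatr_eq0.
have dn : d *+ n.+1 = pi *+ 2 by rewrite -mulr_natr divfK.
have d0 : 0 < d by rewrite divr_gt0// pmulrn_lgt0// pi_gt0.
have next_arc i j s t : s < t < s + pi *+ 2 -> z i = circle_point y r s ->
    z j = circle_point y r t ->
    (forall k u, s < u < t -> z k <> circle_point y r u) -> t - s = d.
  move=> st zi zj empty.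
  (* If the rotated point were not a vertex, the polynomial [q] of degree [n.+1] would have [n.+2]
     roots. *)
  have [k zk] : exists k, z k = circle_point y r (s + d).
    have [/codomP[k]|nin] := boolP (circle_point y r (s + d) \in codom z).
      by exists k.
    pose q : {poly R[i]} := ('X - y%:P) ^+ n.+1 - c%:P.
    have szq : size q = n.+2.
      rewrite size_polyDl ?size_polyN size_exp_XsubC//.
      by rewrite (leq_ltn_trans (size_polyC_leq1 _)).
    have : (size (circle_point y r (s + d) :: codom z) < size q)%N.
      apply: max_poly_roots.
      - by rewrite -size_poly_gt0 szq.
      - apply/allP => x; rewrite inE => /predU1P[->|/codomP[k ->]]; last first.
          by rewrite rootE !hornerE zc subrr.
        rewrite rootE !hornerE circle_point_sub expiD mulrA.
        rewrite exprMn expiX dn expi2pi mulr1 -(zc i) zi.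
        by rewrite circle_point_sub subrr.
      - by rewrite cons_uniq nin map_inj_uniq// enum_uniq.
    by rewrite /= size_codom card_ord szq ltnn.
  (* A longer arc would contain the vertex [z k]. *)
  have td : t - s <= d.
    case: (leP (t - s) d) => // dt; case: (empty k (s + d)) => //.
    by rewrite ltrDl d0/=; lra.
  (* For a shorter arc, [(t - s) *+ n.+1] would lie strictly between 0 and a full turn, while equal
     powers force its [expi] to be 1. *)
  apply/eqP; rewrite eq_le td/= leNgt; apply/negP => lt_d.
  have : expi ((t - s) *+ n.+1) != 1.
    apply: expi_neq1; rewrite pmulrn_lgt0//; apply/andP; split; first lra.
    by rewrite -dn ltr_pMn2r.
  have := zc j; rewrite -(zc i) zi zj !circle_point_sub.
  have -> : expi t = expi s * expi (t - s) by rewrite -expiD addrC subrK.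
  rewrite mulrA exprMn expiX -[X in _ = X]mulr1 => /mulfI -> //.
    by rewrite eqxx.
  by rewrite expf_neq0// mulf_neq0// expi_neq0.
have side_sqr i j :
    is_side z y r i j -> dist (z i) (z j) ^+ 2 = r ^+ 2 * (2 * (1 - cos d)).
  case=> -[s [t [st zi zj empty]]]; rewrite zi zj dist_circle_point.
    by rewrite (next_arc i j s t).
  by rewrite -(opprB t s) cosN (next_arc j i s t).
move=> i j k l /side_sqr ij /side_sqr kl; apply/eqP.
by rewrite -(eqrXn2 (n := 2))// ?dist_ge0// ij kl.
Qed.

End Polygon.

(** * Big operations over pairs of indices *)

(** Pairs are split by whether they contain [i]; [lift i] keeps the order of the other indices. A
    general commutative law covers both the product [dV] and the sum of distances. *)
Lemma big_pairs_lift (T : Type) (idx : T) (op : Monoid.com_law idx) (n : nat)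
    (d : 'I_n.+1 -> 'I_n.+1 -> T) (i : 'I_n.+1) : (forall a b, d a b = d b a) ->
  \big[op/idx]_(a < n.+1) \big[op/idx]_(b < n.+1 | (b < a)%N) d a b =
  op (\big[op/idx]_k d i (lift i k))
    (\big[op/idx]_(a < n) \big[op/idx]_(b < n | (b < a)%N)
       d (lift i a) (lift i b)).
Proof.
move=> dC; rewrite (bigD1_ord i)//=.
under [in X in op _ X]eq_bigr => a _.
  rewrite big_mkcond (bigD1_ord i)//=.
  under [in X in op _ X]eq_bigr => b _ do rewrite !ltnNge leq_bump2 -ltnNge.
  over.
rewrite big_split/= Monoid.mulmA; congr (op _ _); last first.
  by apply: eq_bigr => a _; rewrite -big_mkcond.
rewrite big_mkcond (bigD1_ord i)//= ltnn Monoid.mul1m -big_split/=.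
apply: eq_bigr => k _; case: ltngtP => [||ik].
- by rewrite Monoid.mulm1.
- by rewrite Monoid.mul1m dC.
- by case/eqP: (neq_bump i k).
Qed.

(** Double counting: a pair survives the removal of [i] exactly for the [n.-1] indices [i] outside
    it. *)
Lemma sum_pairs_lift (V : zmodType) (n : nat) (d : 'I_n.+1 -> 'I_n.+1 -> V) :
  (forall a b, d a b = d b a) -> (forall a, d a a = 0) ->
  \sum_(i < n.+1) \sum_(a < n) \sum_(b < n | (b < a)%N) d (lift i a) (lift i b)
  = (\sum_(a < n.+1) \sum_(b < n.+1 | (b < a)%N) d a b) *+ n.-1.
Proof.
move=> dC d0; set S := (X in _ = X *+ _).
(* Summing over all vertices the distances to the others counts each pair from both ends. *)
have sum_star : \sum_i \sum_k d i (lift i k) = S *+ 2.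
  transitivity (\sum_i \sum_j d i j).
    by apply: eq_bigr => i _; rewrite [RHS](bigD1_ord i)//= d0 add0r.
  have -> : S *+ 2 = S + \sum_(a < n.+1) \sum_(b < n.+1 | (a < b)%N) d a b.
    rewrite mulr2n; congr (_ + _); rewrite /S (exchange_big_dep xpredT)//=.
    apply: eq_bigr => a _.
    by apply: eq_big => [b|b _]; rewrite ?andbT 1?dC.
  rewrite -big_split/=; apply: eq_bigr => a _.
  rewrite (bigID (fun b : 'I__ => (b < a)%N))/=; congr (_ + _).
  rewrite (bigD1 a) ?ltnn//= d0 add0r; apply: eq_bigl => b.
  by rewrite -leqNgt ltn_neqAle andbC eq_sym.
have : \sum_(i < n.+1) S = S *+ 2 +
    \sum_(i < n.+1) \sum_(a < n) \sum_(b < n | (b < a)%N) d (lift i a) (lift i b).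
  by rewrite -sum_star -big_split; apply: eq_bigr => i _; apply: big_pairs_lift.
rewrite sumr_const card_ord; case: n => [|n] in d dC d0 S sum_star *.
  by move=> _; rewrite big1// => i _; rewrite big_ord0.
by rewrite (mulrnDr S 2 n) => /addrI <-.
Qed.

(** * The simplex inequality, its equality case and its iteration *)

Section Vandermonde.
Variable R : realType.
Implicit Types (y : R[i]) (r : R).

Lemma normr_dist (x y : R[i]) : `|x - y| = (dist x y)%:C.
Proof. by rewrite /dist; case: (x - y) => a b; rewrite normc_def. Qed.

Lemma distC (x y : R[i]) : dist x y = dist y x.
Proof.
suff /(congr1 (@complex.Re R)) : (dist x y)%:C = (dist y x)%:C by [].
by rewrite -!normr_dist distrC.
Qed.

Lemma dist_gt0 (x y : R[i]) : x != y -> 0 < dist x y.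
Proof.
by rewrite -subr_eq0 -normr_gt0 normr_dist -[0]/(0%:C) ltcR.
Qed.

Lemma dV_ge0 n (z : 'I_n -> R[i]) : 0 <= dV z.
Proof. by do 2!apply: prodr_ge0 => ? _; apply: dist_ge0. Qed.

Lemma dV_lift n (z : 'I_n.+1 -> R[i]) i :
  dV z = (\prod_k dist (z i) (z (lift i k))) * dV (z \o lift i).
Proof. by apply: big_pairs_lift => a b; apply: distC. Qed.

Lemma dV_replace n (z : 'I_n.+1 -> R[i]) i y :
  dV [eta z with i |-> y] =
  (\prod_k dist y (z (lift i k))) * dV (z \o lift i).
Proof.
rewrite (dV_lift _ i) /= eqxx; congr (_ * _).
  by apply: eq_bigr => k _; rewrite eq_sym (negPf (neq_lift _ _)).
rewrite /dV; apply: eq_bigr => a _; apply: eq_bigr => b _ /=.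
by rewrite ![lift i _ == i]eq_sym !(negPf (neq_lift _ _)).
Qed.

(** Pairs avoiding [i] contribute equally to both sides; the remaining distances, from [y] and from
    [z i], have the modulus of the weight as their quotient. *)
Lemma dV_replace_weight n (z : 'I_n.+1 -> R[i]) i y : injective z ->
  (dV [eta z with i |-> y])%:C = (dV z)%:C *
  `|\prod_k ((0 - (z (lift i k) - y)) / ((z i - y) - (z (lift i k) - y)))|.
Proof.
move=> z_inj; rewrite dV_replace (dV_lift z i) normr_prod.
rewrite !rmorphM/= mulrAC; congr (_ * _).
rewrite !rmorph_prod -big_split; apply: eq_bigr => k _ /=.
have zi : z i - z (lift i k) != 0.
  by rewrite subr_eq0; apply/eqP => /z_inj/eqP; rewrite (negPf (neq_lift _ _)).
rewrite sub0r opprB addrA subrK normrM normfV -!normr_dist.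
by rewrite mulrC divfK// normr_eq0.
Qed.

(** The weights of the nodes [z i - y] sum to 1, so their moduli sum to at least 1. *)
Lemma simplex_ineq n (z : 'I_n.+1 -> R[i]) y : injective z ->
  dV z <= \sum_i dV [eta z with i |-> y].
Proof.
move=> z_inj; rewrite -lecR rmorph_sum/=.
under eq_bigr do rewrite dV_replace_weight//.
rewrite -mulr_sumr -[leLHS]mulr1 ler_wpM2l//; first by rewrite lecR dV_ge0.
apply: le_trans (ler_norm_sum _ _ _).
rewrite (lagrange_sum1 (u := fun i => z i - y)) ?normr1//.
by move=> i j /addIr /z_inj.
Qed.

(** Dividing by the nonzero [dV z] turns equality into the moduli of the weights summing to 1, that
    is, into equal powers of all [z i - y]. *)
Lemma simplex_eq n (z : 'I_n.+1 -> R[i]) y r : (2 <= n)%N ->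
  cyclic_ngon z y r ->
  (dV z = \sum_i dV [eta z with i |-> y] <-> equilateral z y r).
Proof.
move=> n2 zyr; have [r0 z_inj zr] := zyr.
have u_inj : injective (fun i => z i - y) by move=> i j /addIr /z_inj.
have rC : 0 < r%:C by rewrite ltcR.
have u_norm i : `|z i - y| = r%:C by rewrite normr_dist zr.
have [wE wE'] := sum_norm_weight_eq1 rC u_inj u_norm.
have dVz : (dV z)%:C != 0.
  rewrite gt_eqF// ltcR; apply: prodr_gt0 => i _; apply: prodr_gt0 => j ji.
  by apply: dist_gt0; apply/eqP => /z_inj ij; rewrite ij ltnn in ji.
have sE : (\sum_i dV [eta z with i |-> y])%:C = (dV z)%:C * \sum_i
    `|\prod_k ((0 - (z (lift i k) - y)) / ((z i - y) - (z (lift i k) - y)))|.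
  rewrite rmorph_sum mulr_sumr; apply: eq_bigr => i _ /=.
  exact: dV_replace_weight.
split=> [eq_dV|eq_sides].
  have [|c zc] := wE.
    by apply: (mulfI dVz); rewrite -sE -eq_dV mulr1.
  exact: expn_equilateral zc.
have sw := wE' (equilateral_expn zyr n2 eq_sides).
suff /(congr1 (@complex.Re R)) :
  (dV z)%:C = (\sum_i dV [eta z with i |-> y])%:C by [].
by rewrite sE sw mulr1.
Qed.

Lemma dV_center n (z : 'I_n.+1 -> R[i]) y r i : (forall j, dist (z j) y = r) ->
  dV [eta z with i |-> y] = r ^+ n * dV (z \o lift i).
Proof.
move=> zr; rewrite dV_replace; congr (_ * _).
under eq_bigr do rewrite distC zr.
by rewrite prodr_const card_ord.
Qed.

(** Here [n] is the number of vertices minus two, so the induction starts at a single distance. Each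
    step applies the simplex inequality at the centre and then the bound to each polygon with one
    vertex removed. *)
Lemma dV_le_sum n (z : 'I_n.+2 -> R[i]) y r :
  injective z -> (forall j, dist (z j) y = r) ->
  dV z <= r ^+ (((n + 3) * n) %/ 2) * n`!%:R
          * \sum_(a < n.+2) \sum_(b < n.+2 | (b < a)%N) dist (z a) (z b).
Proof.
elim: n z => [|n IH] z z_inj zr.
  rewrite muln0 div0n expr0 fact0 !mul1r (dV_lift _ ord0).
  rewrite (big_pairs_lift _ ord0)/=; last first.
    by move=> a b; apply: distC.
  by rewrite /dV !big_ord1 !big_pred0// mulr1 addr0.
apply: le_trans (simplex_ineq y z_inj) _.
have r0 : 0 <= r by rewrite -(zr ord0) dist_ge0.
under eq_bigr do rewrite (dV_center _ zr).
have lift_bound i : r ^+ n.+2 * dV (z \o lift i) <=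
    r ^+ (((n.+1 + 3) * n.+1) %/ 2) * n`!%:R *
    \sum_(a < n.+2) \sum_(b < n.+2 | (b < a)%N) dist (z (lift i a)) (z (lift i b)).
  (* Since (n + 4)(n + 1) = 2(n + 2) + (n + 3)n, the floor division splits without a parity
     argument. *)
  have -> : (((n.+1 + 3) * n.+1) %/ 2 = n.+2 + ((n + 3) * n) %/ 2)%N.
    by rewrite -divnMDl//; congr (_ %/ _)%N; lia.
  rewrite exprD -[X in _ <= X * _]mulrA -[leRHS]mulrA ler_wpM2l ?exprn_ge0//.
  by apply: IH => [j k /z_inj /lift_inj|j]; last exact: zr.
apply: le_trans (ler_sum _ (fun i _ => lift_bound i)) _.
(* Each distance is counted [n.+1] times, which turns the factorial of [n] into that of [n.+1]. *)
rewrite -mulr_sumr (sum_pairs_lift (d := fun a b => dist (z a) (z b))).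
- by rewrite /= factS natrM -mulr_natr le_eqVlt; apply/orP; left; apply/eqP; ring.
- by move=> a b; apply: distC.
- by move=> a; rewrite /dist subrr ComplexField.Normc.normc0.
Qed.

End Vandermonde.

(** * Triangles, quadrangles and the final statement *)

Lemma dV3 (R : realType) (z : 'I_3 -> R[i]) :
  dV z = dist (z 0) (z 1) * dist (z 0) (z 2) * dist (z 1) (z 2).
Proof.
have [e1 e2] : lift ord0 ord0 = 1 :> 'I_3 /\ lift ord0 (lift ord0 ord0) = 2 :> 'I_3.
  by split; apply: val_inj.
rewrite /dV; under eq_bigr do rewrite big_mkcond.
rewrite !big_ord_recl !big_ord0 /= !mul1r !mulr1 e1 e2.
by rewrite mulrA ![dist _ (z 0)]distC [dist (z 2) _]distC.
Qed.

Lemma dV4 (R : realType) (z : 'I_4 -> R[i]) :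
  dV z = dist (z 0) (z 1) * dist (z 0) (z 2) * dist (z 0) (z 3) *
    (dist (z 1) (z 2) * dist (z 1) (z 3) * dist (z 2) (z 3)).
Proof.
rewrite (dV_lift _ 0) dV3 !big_ord_recl big_ord0 /= mulr1 !mulrA.
by do 5?congr (_ * _); congr (dist _ _); congr (z _); apply: val_inj.
Qed.

Theorem corollary3 (R : realType) :
  (* (i) *)
  (forall (z : 'I_3 -> R[i]) (y : R[i]) (r a b c : R),
     cyclic_ngon z y r ->
     a = dist (z 0) (z 1) -> b = dist (z 1) (z 2) -> c = dist (z 2) (z 0) ->
     a * b * c <= r ^+ 2 * (a + b + c) /\
     (a * b * c = r ^+ 2 * (a + b + c) <-> equilateral z y r)) /\
  (* (ii) *)
  (forall (z : 'I_4 -> R[i]) (y : R[i]) (r a b c d e f : R),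
     cyclic_ngon z y r ->
     is_side z y r 0 1 -> is_side z y r 1 2 ->
     is_side z y r 2 3 -> is_side z y r 3 0 ->
     a = dist (z 0) (z 1) -> b = dist (z 1) (z 2) ->
     c = dist (z 2) (z 3) -> d = dist (z 3) (z 0) ->
     e = dist (z 0) (z 2) -> f = dist (z 1) (z 3) ->
     a * b * c * d * e * f
       <= r ^+ 3 * (a * b * e + b * c * f + c * d * e + a * d * f) /\
     (a * b * c * d * e * f
        = r ^+ 3 * (a * b * e + b * c * f + c * d * e + a * d * f)
      <-> equilateral z y r)) /\
  (* (iii) *)
  (forall (n : nat) (z : 'I_n -> R[i]) (y : R[i]) (r : R),
     (3 <= n)%N -> cyclic_ngon z y r ->
     \prod_(i < n) \prod_(j < n | (j < i)%N) dist (z i) (z j)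
       <= r ^+ (((n + 1) * (n - 2)) %/ 2) * ((n - 2)`!)%:R
          * \sum_(i < n) \sum_(j < n | (j < i)%N) dist (z i) (z j)) /\
  (* (iv) *)
  (forall (n : nat) (z : 'I_n -> R[i]) (y : R[i]) (r : R),
     (3 <= n)%N -> cyclic_ngon z y r ->
     (dV z = \sum_(i < n) dV [eta z with i |-> y] <-> equilateral z y r)).
Proof.
split=> [z y r a b c zyr -> -> ->|].
  have [_ z_inj zr] := zyr.
  have dVz : dV z = dist (z 0) (z 1) * dist (z 1) (z 2) * dist (z 2) (z 0).
    by rewrite dV3 [dist (z 2) _]distC mulrAC.
  (* Replacing a vertex by the centre leaves the opposite side times two radii. *)
  have sE : \sum_i dV [eta z with i |-> y] = r ^+ 2 *
      (dist (z 0) (z 1) + dist (z 1) (z 2) + dist (z 2) (z 0)).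
    rewrite !big_ord_recl big_ord0 /= !dV3 /= !(distC y) !zr [dist (z 2) _]distC.
    by ring.
  rewrite -dVz -sE; split; first exact: simplex_ineq.
  exact: simplex_eq.
split=> [z y r a b c d e f zyr _ _ _ _ -> -> -> -> -> ->|].
  have [_ z_inj zr] := zyr.
  have dVz : dV z = dist (z 0) (z 1) * dist (z 1) (z 2) * dist (z 2) (z 3) *
      dist (z 3) (z 0) * dist (z 0) (z 2) * dist (z 1) (z 3).
    by rewrite dV4 [dist (z 3) _]distC; ring.
  (* Replacing a vertex by the centre leaves three radii times the sides of the triangle on the
     other vertices: two sides and a diagonal. *)
  have sE : \sum_i dV [eta z with i |-> y] = r ^+ 3 *
      (dist (z 0) (z 1) * dist (z 1) (z 2) * dist (z 0) (z 2) +
       dist (z 1) (z 2) * dist (z 2) (z 3) * dist (z 1) (z 3) +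
       dist (z 2) (z 3) * dist (z 3) (z 0) * dist (z 0) (z 2) +
       dist (z 0) (z 1) * dist (z 3) (z 0) * dist (z 1) (z 3)).
    rewrite !big_ord_recl big_ord0 /= !dV4 /= !(distC y) !zr [dist (z 3) _]distC.
    by ring.
  rewrite -dVz -sE; split; first exact: simplex_ineq.
  exact: simplex_eq.
split=> [] [|[|n]] z y r //= n3 zyr; have [_ z_inj zr] := zyr.
  have -> : (((n.+2 + 1) * (n.+2 - 2)) %/ 2 = ((n + 3) * n) %/ 2)%N.
    by congr (_ %/ _)%N; lia.
  by rewrite -/(dV z) !subSS subn0; apply: dV_le_sum zr.
exact: simplex_eq.
Qed.
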